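(* Let $G$ be a finite connected graph with incidence matrix $B$, edge space $X=\mathbb{R}^E$, and first Betti number $b_1=\dim\ker B$. Let $H:\mathbb{R}^{b_1}\to X$ be a linear map whose columns form a Euclidean-orthonormal basis of $\ker B$. Let $S:X\to\mathbb{R}^{n_s}$ (sensor map) and $C:\mathbb{R}^{n_a}\to X$ (actuator map) be linear maps such that $$\operatorname{rank}(SH)=b_1,\qquad \operatorname{rank}(H^\top C)=b_1 .$$ Then, for every $\kappa>0$, there exists a linear map $K:\mathbb{R}^{n_s}\to\mathbb{R}^{n_a}$ such that $$H^\top CKSH=-\kappa I_{b_1}.$$ Put $G_C:=H^\top C:\mathbb{R}^{n_a}\to\mathbb{R}^{b_1}$ and $G_S:=SH:\mathbb{R}^{b_1}\to\mathbb{R}^{n_s}$. If $G_C^R$ is any right inverse of $G_C$ and $G_S^L$ is any left inverse of $G_S$, then $$K_0=-\kappa G_C^RG_S^L$$ is one solution, and all solutions are exactly the maps of the form $$K=K_0+Z,\qquad G_CZG_S=0 .$$ This affine space of solutions has dimension $n_an_s-b_1^2$, and the Moore--Penrose choice $K_{\min}=-\kappa G_C^\dagger G_S^\dagger$ is the solution of minimum Frobenius norm (for the Euclidean inner products on $\mathbb{R}^{n_s}$ and $\mathbb{R}^{n_a}$). In the minimal square case $n_a=n_s=b_1$, the solution is $$K=-\kappa(H^\top C)^{-1}(SH)^{-1}.$$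
   Context: $G=(V,E)$ is a finite connected graph with $n=|V|$, $m=|E|$, and a fixed reference orientation of each edge; the incidence matrix $B:\mathbb{R}^E\to\mathbb{R}^n$ has, in the column of each oriented edge, entry $+1$ at the tail and $-1$ at the head. Then $b_1=m-n+1=\dim\ker B$. $M^\dagger$ denotes the Moore--Penrose inverse of a matrix $M$; a right inverse of $G_C$ satisfies $G_CG_C^R=I_{b_1}$ and a left inverse of $G_S$ satisfies $G_S^LG_S=I_{b_1}$. *)

(* Defs.v *)
From mathcomp Require Import all_boot all_order all_algebra.
From mathcomp Require Import boolp classical_sets reals.

Set Implicit Arguments.
Unset Strict Implicit.
Unset Printing Implicit Defensive.
Import Order.TTheory GRing.Theory Num.Theory.
Local Open Scope ring_scope.

(* Throughout, a linear map R^q -> R^p is a p x q matrix acting on column vectors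
   by left multiplication. *)

(* A finite graph with a reference orientation is given by its finite types of
   vertices and edges and the endpoint maps [etail] and [ehead]; parallel edges
   are allowed, and a loop has a zero column in the incidence matrix. *)
Section Graph.
Variables (V E : finType) (etail ehead : E -> V).

Definition adjacent : rel V := fun x y =>
  [exists e, (etail e == x) && (ehead e == y)
          || (etail e == y) && (ehead e == x)].

(* The empty graph is not connected. *)
Definition connected_graph : Prop :=
  (0 < #|V|)%N /\ forall x y : V, connect adjacent x y.

Definition incidence (R : realType) : 'M[R]_(#|V|, #|E|) :=
  \matrix_(i, j) ((enum_val i == etail (enum_val j))%:R
                - (enum_val i == ehead (enum_val j))%:R).

(* The columns of [cokermx B] span the vectors [x] such that [B *m x = 0]. *)
Definition betti1 (R : realType) : nat := \rank (cokermx (incidence R)).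

Lemma betti1E (R : realType) :
  connected_graph -> (betti1 R + #|V| = #|E| + 1)%N.
Proof.
move=> [V0 conn]; set B := incidence R.
have Bcol (u : 'rV[R]_#|V|) (j : 'I_#|E|) : (u *m B) 0 j =
    u 0 (enum_rank (etail (enum_val j))) - u 0 (enum_rank (ehead (enum_val j))).
  rewrite !mxE; under eq_bigr do rewrite !mxE mulrBr.
  rewrite sumrB; congr (_ - _).
    rewrite (bigD1 (enum_rank (etail (enum_val j)))) //= enum_rankK eqxx mulr1.
    rewrite big1 ?addr0 // => i; rewrite -(inj_eq enum_val_inj) enum_rankK.
    by move=> /negPf ->; rewrite mulr0.
  rewrite (bigD1 (enum_rank (ehead (enum_val j)))) //= enum_rankK eqxx mulr1.
  rewrite big1 ?addr0 // => i; rewrite -(inj_eq enum_val_inj) enum_rankK.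
  by move=> /negPf ->; rewrite mulr0.
have kerB (u : 'rV[R]_#|V|) : u *m B = 0 -> exists a, u = a *: const_mx 1.
  move=> uB; have [v0 _] : exists v : V, v \in V by apply/card_gt0P.
  exists (u 0 (enum_rank v0)); apply/rowP => i; rewrite !mxE mulr1.
  have step x y : adjacent x y -> u 0 (enum_rank x) = u 0 (enum_rank y).
    case/existsP => e; have := Bcol u (enum_rank e).
    rewrite uB enum_rankK mxE => /esym/eqP; rewrite subr_eq0 => /eqP he.
    by case/orP => /andP[/eqP <- /eqP <-].
  have /connectP[p pp lp] := conn v0 (enum_val i).
  rewrite -[i in LHS]enum_valK lp {lp i}.
  elim: p v0 pp => //= y p IHp x /andP[xy yp].
  by rewrite (step _ _ xy); apply: IHp.
have rk1 : \rank (kermx B) = 1%N.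
  have -> : \rank (kermx B) = \rank (const_mx 1 : 'rV[R]_#|V|).
    apply/eqP; rewrite eqn_leq !mxrankS //.
      apply/sub_kermxP/rowP => j; rewrite Bcol !mxE.
      by rewrite subrr.
    apply/row_subP => i; have [|a ->] := kerB (row i (kermx B)).
      by rewrite -row_mul mulmx_ker row0.
    exact: scalemx_sub.
  rewrite rank_rV; case: eqP => // /rowP/(_ (Ordinal V0)).
  by rewrite !mxE => /eqP; rewrite oner_eq0.
rewrite /betti1 -/B mxrank_coker; move: rk1; rewrite mxrank_ker.
move=> rk; have rn := rank_leq_row B; have rm := rank_leq_col B.
have nE : #|V| = (1 + \rank B)%N by rewrite -rk subnK.
by rewrite [X in (_ + X)%N]nE addnCA subnK // addnC.
Qed.

End Graph.

Definition orthonormal_ker_basis (R : realType) (n m b : nat)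
    (B : 'M[R]_(n, m)) (H : 'M[R]_(m, b)) : Prop :=
  H^T *m H = 1%:M /\
  forall x : 'cV[R]_m, B *m x = 0 <-> exists y : 'cV[R]_b, x = H *m y.

Definition penrose (R : realType) (m n : nat)
    (A : 'M[R]_(m, n)) (X : 'M[R]_(n, m)) : Prop :=
  [/\ A *m X *m A = A, X *m A *m X = X,
      (A *m X)^T = A *m X & (X *m A)^T = X *m A].

Definition mpinv (R : realType) (m n : nat) (A : 'M[R]_(m, n)) : 'M[R]_(n, m) :=
  xget 0 [set X | penrose A X]%classic.

Lemma penrose_uniq (R : realType) (m n : nat) (A : 'M[R]_(m, n))
    (X Y : 'M[R]_(n, m)) : penrose A X -> penrose A Y -> X = Y.
Proof.
move=> [X1 X2 X3 X4] [Y1 Y2 Y3 Y4].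
have AXY : A *m X = A *m Y.
  rewrite -X3 -[A in LHS]Y1 -(mulmxA (A *m Y)) trmx_mul X3 Y3.
  by rewrite mulmxA X1.
have XYA : X *m A = Y *m A.
  rewrite -X4 -[A in LHS]Y1 -(mulmxA A) mulmxA trmx_mul X4 Y4.
  by rewrite -mulmxA [A *m _]mulmxA X1.
by rewrite -X2 XYA -mulmxA AXY mulmxA Y2.
Qed.

Lemma gram_unit (R : realType) (m n : nat) (N : 'M[R]_(m, n)) :
  row_free N -> N *m N^T \in unitmx.
Proof.
move=> Nfree; rewrite -row_free_unit -kermx_eq0; apply/rowV0P => u.
move=> /sub_kermxP uN; apply/(row_free_inj Nfree); rewrite mul0mx.
have /matrixP/(_ 0 0) : (u *m N) *m (u *m N)^T = 0.
  by rewrite trmx_mul mulmxA -(mulmxA u) uN mul0mx.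
rewrite !mxE => /eqP; rewrite psumr_eq0; last first.
  by move=> i _; rewrite [_^T _ _]mxE -expr2 sqr_ge0.
move=> /allP h; apply/rowP => j; have := h j (mem_index_enum _).
by rewrite [_^T _ _]mxE -expr2 sqrf_eq0 /= => /eqP ->; rewrite mxE.
Qed.

Lemma mpinvP (R : realType) (m n : nat) (A : 'M[R]_(m, n)) :
  penrose A (mpinv A).
Proof.
apply: (@xgetPex _ 0 [set X | penrose A X]%classic).
have [r [L [M [gL gM ->]]]] : exists r (L : 'M[R]_(m, r)) (M : 'M[R]_(r, n)),
    [/\ L^T *m L \in unitmx, M *m M^T \in unitmx & A = L *m M].
  exists (\rank A), (col_base A), (row_base A); split.
  - rewrite -[X in _ *m X]trmxK; apply: gram_unit.
    by rewrite /row_free mxrank_tr; exact: col_base_full.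
  - by apply: gram_unit; exact: row_base_free.
  - by rewrite mulmx_base.
have sL : (L^T *m L)^T = L^T *m L by rewrite trmx_mul trmxK.
have sM : (M *m M^T)^T = M *m M^T by rewrite trmx_mul trmxK.
exists (M^T *m invmx (M *m M^T) *m (invmx (L^T *m L) *m L^T)).
set P := invmx _; set Q := invmx _.
have MP : M *m (M^T *m P) = 1%:M by rewrite mulmxA mulmxV.
have QL : (Q *m L^T) *m L = 1%:M by rewrite -mulmxA mulVmx.
have AX : L *m M *m (M^T *m P *m (Q *m L^T)) = L *m (Q *m L^T).
  by rewrite -[LHS]mulmxA (mulmxA M) MP mul1mx.
have XA : (M^T *m P *m (Q *m L^T)) *m (L *m M) = M^T *m P *m M.
  by rewrite -[LHS]mulmxA (mulmxA (Q *m L^T)) QL mul1mx.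
split; rewrite ?AX ?XA.
- by rewrite -[LHS]mulmxA (mulmxA (Q *m L^T)) QL mul1mx.
- by rewrite -[LHS]mulmxA (mulmxA M) MP mul1mx.
- by rewrite !trmx_mul trmxK trmx_inv sL mulmxA.
- by rewrite !trmx_mul trmxK trmx_inv sM mulmxA.
Qed.

(* The norm that the library puts on matrices is the maximum of the entries. *)
Definition frobenius (R : realType) (m n : nat) (A : 'M[R]_(m, n)) : R :=
  Num.sqrt (\sum_i \sum_j A i j ^+ 2).

(* [A0] satisfies [P], so the affine subspace is nonempty. *)
Definition affine_of_dim (R : realType) (m n : nat)
    (P : 'M[R]_(m, n) -> Prop) (d : nat) : Prop :=
  exists (A0 : 'M[R]_(m, n)) (W : {vspace 'M[R]_(m, n)}),
    (forall A, P A <-> A - A0 \in W) /\ \dim W = d.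

Definition assigns (R : realType) (m b ns na : nat) (H : 'M[R]_(m, b))
    (S : 'M[R]_(ns, m)) (C : 'M[R]_(m, na)) (kappa : R)
    (K : 'M[R]_(na, ns)) : Prop :=
  H^T *m C *m K *m S *m H = - kappa *: 1%:M.

(* Main.v *)
Require Import Defs.
From mathcomp Require Import all_boot all_order all_algebra.
From mathcomp Require Import boolp classical_sets reals.

Set Implicit Arguments.
Unset Strict Implicit.
Unset Printing Implicit Defensive.
Import Order.TTheory GRing.Theory Num.Theory.
Local Open Scope ring_scope.

(** Associativity turns the assignment condition into the linear matrix equation
    [GC *m K *m GS = - kappa *: 1%:M], where the rank hypotheses say that [GC]
    has a right inverse and [GS] a left inverse.  Hence the linear map
    [Z |-> GC *m Z *m GS] is onto: [GCR *m D *m GSL] is a preimage of [D]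
    ([sandwich_inv]).  A solution exists, the solutions form a coset of the
    kernel of this map, and the rank-nullity theorem gives the dimension of that
    kernel ([dim_lker_sandwich]).

    For the minimum of the norm, the pseudoinverse of a matrix of full row or
    column rank is a one-sided inverse, so [Kmin] is a solution.  The Penrose
    equations also factor the transposed pseudoinverses, as [_ *m GC] and
    [GS *m _] respectively; by cyclicity of the trace, [Kmin] is therefore
    orthogonal, for the Frobenius inner product [\tr (A^T *m B)], to every [Z]
    with [GC *m Z *m GS = 0] ([mpinv_orthogonal]).  Pythagoras finishes
    ([frobenius_lt_addr]).  In the square case both factors are invertible and
    cancelling them leaves a single solution. *)

(** * The map [Z |-> A *m Z *m B] *)

Section Sandwich.
Variables (F : fieldType) (p m n q : nat) (A : 'M[F]_(p, m)) (B : 'M[F]_(n, q)).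

Definition sandwich : 'Hom('M[F]_(m, n), 'M[F]_(p, q)) :=
  linfun (mulmxr B \o mulmx A).

Lemma sandwichE Z : sandwich Z = A *m Z *m B.
Proof. by rewrite lfunE. Qed.

Variables (AR : 'M[F]_(m, p)) (BL : 'M[F]_(q, n)).
Hypotheses (AAR : A *m AR = 1%:M) (BLB : BL *m B = 1%:M).

Lemma sandwich_inv (D : 'M[F]_(p, q)) : A *m (AR *m D *m BL) *m B = D.
Proof. by rewrite !mulmxA AAR mul1mx -mulmxA BLB mulmx1. Qed.

Lemma dim_lker_sandwich : \dim (lker sandwich) = (m * n - p * q)%N.
Proof.
have img : limg sandwich = fullv.
  apply/vspaceP => D; rewrite memvf; apply/memv_imgP.
  by exists (AR *m D *m BL); rewrite ?memvf // sandwichE sandwich_inv.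
have := limg_ker_dim sandwich fullv.
by rewrite capfv img !dimvf /dim /= => <-; rewrite addnK.
Qed.

Lemma sandwich_solutions (D : 'M[F]_(p, q)) (K0 K : 'M[F]_(m, n)) :
  A *m K0 *m B = D ->
  A *m K *m B = D <-> exists Z, A *m Z *m B = 0 /\ K = K0 + Z.
Proof.
move=> K0D; split=> [KD | [Z [Z0 ->]]]; last first.
  by rewrite mulmxDr mulmxDl K0D Z0 addr0.
exists (K - K0); split; last by rewrite addrC subrK.
by rewrite mulmxBr mulmxBl KD K0D subrr.
Qed.

End Sandwich.

(** * The Frobenius norm *)

Lemma sum_sqr_mxtrace (R : realType) (m n : nat) (A : 'M[R]_(m, n)) :
  \sum_i \sum_j A i j ^+ 2 = \tr (A^T *m A).
Proof.
rewrite exchange_big; apply: eq_bigr => j _; rewrite mxE.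
by apply: eq_bigr => i _; rewrite mxE expr2.
Qed.

Lemma mxtrace_gram_ge0 (R : realType) (m n : nat) (A : 'M[R]_(m, n)) :
  0 <= \tr (A^T *m A).
Proof.
rewrite -sum_sqr_mxtrace.
by apply: sumr_ge0 => i _; apply: sumr_ge0 => j _; apply: sqr_ge0.
Qed.

Lemma mxtrace_gram_gt0 (R : realType) (m n : nat) (A : 'M[R]_(m, n)) :
  A != 0 -> 0 < \tr (A^T *m A).
Proof.
move=> A0; rewrite lt0r mxtrace_gram_ge0 andbT -sum_sqr_mxtrace.
apply: contraNneq A0 => A0; apply/eqP/matrixP => i j; rewrite mxE; apply/eqP.
have sq0 k : 0 <= \sum_l A k l ^+ 2 by apply: sumr_ge0 => l _; apply: sqr_ge0.
have /psumr_eq0P/(_ A0 i isT)/psumr_eq0P rowi :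
    forall k, true -> 0 <= \sum_l A k l ^+ 2 by [].
by rewrite -sqrf_eq0 rowi // => l _; apply: sqr_ge0.
Qed.

(** Pythagoras: the cross terms vanish, so the squared norms add up. *)
Lemma frobenius_lt_addr (R : realType) (m n : nat) (A Z : 'M[R]_(m, n)) :
  \tr (A^T *m Z) = 0 -> Z != 0 -> frobenius A < frobenius (A + Z).
Proof.
move=> AZ /mxtrace_gram_gt0 Zgt0; rewrite /frobenius !sum_sqr_mxtrace.
have ZA : \tr (Z^T *m A) = 0 by rewrite -mxtrace_tr trmx_mul trmxK.
have -> : \tr ((A + Z)^T *m (A + Z)) = \tr (A^T *m A) + \tr (Z^T *m Z).
  rewrite [(A + Z)^T]linearD /= mulmxDl !mulmxDr !mxtraceD AZ ZA.
  by rewrite addr0 add0r.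
by rewrite ltr_sqrt ?ltrDl // ltr_wpDl // mxtrace_gram_ge0.
Qed.

(** * Pseudoinverses *)

Section PseudoInverse.
Variable R : realType.

(** A Penrose equation reads [(A *m mpinv A - 1%:M) *m A = 0], and a matrix with
    independent rows can be cancelled on the right. *)
Lemma mulmx_mpinv (m n : nat) (A : 'M[R]_(m, n)) :
  row_free A -> A *m mpinv A = 1%:M.
Proof.
move=> Afree; apply: (row_free_inj Afree); rewrite mul1mx.
by case: (mpinvP A).
Qed.

Lemma mulmx_mpinv_l (m n : nat) (A : 'M[R]_(m, n)) :
  row_full A -> mpinv A *m A = 1%:M.
Proof.
move=> Afull; apply: (row_full_inj Afull); rewrite mulmx1 mulmxA.
by case: (mpinvP A).
Qed.

(** The symmetry of [X *m A], for [X := mpinv A], turns [X = X *m A *m X] into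
    [X = A^T *m X^T *m X]; likewise for [Y := mpinv B] with the symmetry of
    [B *m Y].  Thus [(X *m Y)^T] is a product [B *m W *m A], whose trace against
    [Z] is the trace of [W *m (A *m Z *m B)], by cyclicity. *)
Lemma mpinv_orthogonal (p m n : nat) (A : 'M[R]_(p, m)) (B : 'M[R]_(n, p))
    (Z : 'M[R]_(m, n)) :
  A *m Z *m B = 0 -> \tr ((mpinv A *m mpinv B)^T *m Z) = 0.
Proof.
move=> AZB.
have [_ XAX _ XAs] := mpinvP A; have [_ YBY BYs _] := mpinvP B.
set X := mpinv A in XAX XAs *; set Y := mpinv B in YBY BYs *.
have XT : X^T = X^T *m X *m A by rewrite -mulmxA -[X in LHS]XAX trmx_mul XAs.
have YT : Y^T = B *m Y *m Y^T by rewrite -[Y in LHS]YBY -mulmxA trmx_mul BYs.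
rewrite trmx_mul XT YT -!mulmxA mxtrace_mulC -!mulmxA.
by rewrite [A *m _]mulmxA AZB !mulmx0 linear0.
Qed.

End PseudoInverse.

(** * The solutions of the assignment equation *)

Lemma assignsE (R : realType) (m b ns na : nat) (H : 'M[R]_(m, b))
    (S : 'M[R]_(ns, m)) (C : 'M[R]_(m, na)) (kappa : R) (K : 'M[R]_(na, ns)) :
  assigns H S C kappa K = (H^T *m C *m K *m (S *m H) = - kappa *: 1%:M).
Proof. by rewrite /assigns !mulmxA. Qed.

Theorem theorem8p3 (R : realType) (V E : finType) (etail ehead : E -> V)
  (conn : connected_graph etail ehead)
  (b1 : nat) (hb1 : b1 = betti1 etail ehead R)
  (H : 'M[R]_(#|E|, b1))
  (hH : orthonormal_ker_basis (incidence etail ehead R) H) :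
  (forall (ns na : nat) (S : 'M[R]_(ns, #|E|)) (C : 'M[R]_(#|E|, na)),
    \rank (S *m H) = b1 ->
    \rank (H^T *m C) = b1 ->
    forall kappa : R, 0 < kappa ->
    let GC := H^T *m C in
    let GS := S *m H in
    let Kmin := - kappa *: (mpinv GC *m mpinv GS) in
    [/\ exists K : 'M[R]_(na, ns), assigns H S C kappa K,
        forall (GCR : 'M[R]_(na, b1))
               (GSL : 'M[R]_(b1, ns)),
          GC *m GCR = 1%:M -> GSL *m GS = 1%:M ->
          let K0 := - kappa *: (GCR *m GSL) in
          assigns H S C kappa K0 /\
          forall K : 'M[R]_(na, ns), assigns H S C kappa K <->
            exists Z : 'M[R]_(na, ns), GC *m Z *m GS = 0 /\ K = K0 + Z,
        affine_of_dim (assigns H S C kappa)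
          (na * ns - b1 ^ 2)%N &
        assigns H S C kappa Kmin /\
        forall K : 'M[R]_(na, ns), assigns H S C kappa K -> K <> Kmin ->
          frobenius Kmin < frobenius K])
  /\
  (forall (S : 'M[R]_(b1, #|E|))
          (C : 'M[R]_(#|E|, b1)),
    \rank (S *m H) = b1 ->
    \rank (H^T *m C) = b1 ->
    forall kappa : R, 0 < kappa ->
    [/\ H^T *m C \in unitmx, S *m H \in unitmx &
        forall K : 'M[R]_(b1), assigns H S C kappa K <->
          K = - kappa *: (invmx (H^T *m C) *m invmx (S *m H))]).
Proof.
split=> [ns na S C rkS rkC kappa _ GC GS Kmin | S C rkS rkC kappa _].
  have GCfree : row_free GC by rewrite /row_free rkC.
  have GSfull : row_full GS by rewrite /row_full rkS.
  have sol (GCR : 'M_(na, b1)) (GSL : 'M_(b1, ns)) :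
      GC *m GCR = 1%:M -> GSL *m GS = 1%:M ->
      assigns H S C kappa (- kappa *: (GCR *m GSL)).
    move=> GCK GSK; rewrite assignsE.
    have := sandwich_inv GCK GSK (- kappa *: 1%:M).
    by rewrite -scalemxAr mulmx1 -scalemxAl.
  have GCX := mulmx_mpinv GCfree; have GSX := mulmx_mpinv_l GSfull.
  have Kmin_sol : assigns H S C kappa Kmin by apply: sol.
  have gen (K0 K : 'M_(na, ns)) : assigns H S C kappa K0 ->
      assigns H S C kappa K <-> exists Z, GC *m Z *m GS = 0 /\ K = K0 + Z.
    by rewrite !assignsE; apply: sandwich_solutions.
  split.
  - by exists Kmin.
  - move=> GCR GSL GCK GSK K0; have K0sol : assigns H S C kappa K0 by apply: sol.
    by split=> // K; apply: gen.
  - exists Kmin, (lker (sandwich GC GS)); split; last first.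
      by rewrite (dim_lker_sandwich GCX GSX) mulnn.
    move=> K; rewrite memv_ker sandwichE; apply: (iff_trans (gen Kmin K Kmin_sol)).
    split=> [[Z [Z0 ->]] | /eqP Z0]; first by rewrite addrC addKr Z0.
    by exists (K - Kmin); split; last rewrite addrC subrK.
  - split=> // K /(gen _ _ Kmin_sol)[Z [Z0 ->]] neq.
    apply: frobenius_lt_addr; last by apply: contra_not_neq neq => ->; rewrite addr0.
    by rewrite linearZ /= -scalemxAl linearZ /= (mpinv_orthogonal Z0) mulr0.
have GCu : H^T *m C \in unitmx by rewrite -row_free_unit /row_free rkC.
have GSu : S *m H \in unitmx by rewrite -row_free_unit /row_free rkS.
split=> // K; rewrite assignsE; split=> [KP | ->].
  have -> : K = invmx (H^T *m C) *m (H^T *m C *m K *m (S *m H)) *m invmx (S *m H).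
    by rewrite -!(mulmxA (H^T *m C)) mulKmx // mulmxK.
  by rewrite KP -scalemxAr mulmx1 scalemxAl.
by rewrite -scalemxAr -scalemxAl mulKVmx // mulVmx.
Qed.
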